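(* Let $\mathcal{F}_1,\dots,\mathcal{F}_4$ be finite families of compact convex sets in $\mathbb{R}^2$ such that every colorful collection of four sets can be pierced by a line, and let $v$ be a fixed direction in $\mathbb{R}^2$. Then there exists $1\leq i\leq 4$ such that $\mathcal{F}_i$ is pierced by two lines, one of which is parallel to $v$.
   Context: A colorful collection of four sets is a choice of sets $F_1\in\mathcal{F}_1$, $F_2\in\mathcal{F}_2$, $F_3\in\mathcal{F}_3$, $F_4\in\mathcal{F}_4$ (one set from each family). A family of sets in $\mathbb{R}^2$ is pierced by $k$ lines if there exist $k$ lines in $\mathbb{R}^2$ whose union intersects every set in the family. In particular, a collection of sets is pierced by a line if there is a single line intersecting every set in it. *)

(* Defs.v *)
From mathcomp Require Import all_boot all_order all_algebra.
From mathcomp Require Import all_classical all_reals all_analysis.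

Set Implicit Arguments.
Unset Strict Implicit.
Unset Printing Implicit Defensive.

Import Order.TTheory GRing.Theory Num.Theory.
Import numFieldNormedType.Exports.

Local Open Scope classical_set_scope.
Local Open Scope ring_scope.

(* A line only when d != 0. *)
Definition line_through (R : realType) (p d : 'rV[R]_2) : set 'rV[R]_2 :=
  [set p + t *: d | t in [set: R]].

Definition is_line (R : realType) (L : set 'rV[R]_2) : Prop :=
  exists p d : 'rV[R]_2, d != 0 /\ L = line_through p d.

(* Meaningful when v != 0; the lines with direction a nonzero multiple of v
   are the same point sets. *)
Definition parallel_to (R : realType) (L : set 'rV[R]_2) (v : 'rV[R]_2) : Prop :=
  exists p : 'rV[R]_2, L = line_through p v.

(* The lines L i need not be distinct. *)
Definition pierced_by_lines (R : realType) (k : nat)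
    (F : set (set 'rV[R]_2)) (L : 'I_k -> set 'rV[R]_2) : Prop :=
  (forall i, is_line (L i)) /\
  (forall A, F A -> (\bigcup_i L i) `&` A !=set0).

Definition pierced_by_a_line (R : realType) (F : set (set 'rV[R]_2)) : Prop :=
  exists L : set 'rV[R]_2, is_line L /\ forall A, F A -> L `&` A !=set0.

Definition colorful (R : realType) (n : nat) (F : 'I_n -> set (set 'rV[R]_2))
    (C : 'I_n -> set 'rV[R]_2) : Prop :=
  forall i, F i (C i).

(* Main.v *)
Require Import Defs.
From Stdlib Require Import Btauto.
From mathcomp Require Import all_boot all_order all_algebra.
From mathcomp Require Import all_classical all_reals all_analysis.
From mathcomp Require Import zify ring lra.

(* For each parameter in the cube [-1, 1]^3 take a line parallel to v together
   with a second line crossing it; they cut the plane into four open quadrants.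
   If no F_i is pierced by such a pair then, by convexity, for every parameter
   each F_i has a member inside one quadrant. The parametrisation is chosen so
   that certain quadrants miss all the sets on each face of the cube, which is
   the boundary condition of a Sperner labelling. In Kuhn's triangulation of a
   fine grid the vertices of each tetrahedron have distinct coordinate sums
   modulo 4; letting the vertex of sum i use the family F_i, a tetrahedron with
   four distinct labels yields a colorful collection occupying all four
   quadrants of a single pair of lines (by a Lebesgue number argument). But a
   line meets at most three of the four quadrants. *)

Set Implicit Arguments.
Unset Strict Implicit.
Unset Printing Implicit Defensive.

Import Order.TTheory GRing.Theory Num.Theory.
Import numFieldNormedType.Exports.

(** * Sperner's lemma on the Kuhn triangulation of a cubical grid *)

(* A label [(right, top)] names a quadrant. The doors of the parity argument are
   the triangles labelled left-top, left-bottom, right-top (so never the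
   right-bottom label [(true, false)]) and, one dimension lower, the edges
   labelled left-top, left-bottom. *)
Definition door2 (k l : bool * bool) : bool :=
  [&& ~~ k.1, ~~ l.1 & k.2 (+) l.2].

Definition door3 (k l m : bool * bool) : bool :=
  uniq [:: k; l; m] && ((true, false) \notin [:: k; l; m]).

Lemma addbE a b : a (+) b = xorb a b.
Proof. by case: a b => [] []. Qed.

(** With three labels available, a triangle carrying all of them has one door edge; any other has
    none or two. *)
Lemma door3_triangle k l m :
  (true, false) \notin [:: k; l; m] ->
  door3 k l m = door2 k l (+) door2 k m (+) door2 l m.
Proof. by case: k l m => [[] []] [[] []] [[] []]. Qed.

(** A tetrahedron with four distinct labels has one door face; any other has none or two, the two
    faces omitting one of the equally labelled vertices. *)
Lemma door3_tetrahedron k l m n :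
  uniq [:: k; l; m; n] =
  door3 k l m (+) door3 k l n (+) (door3 k m n (+) door3 l m n).
Proof. by case: k l m n => [[] []] [[] []] [[] []] [[] []]. Qed.

Lemma telescope_addb (g : nat -> bool) n :
  \big[addb/false]_(i < n) (g i (+) g i.+1) = g 0 (+) g n.
Proof.
elim: n => [|n IH]; first by rewrite big_ord0 addbb.
by rewrite big_ord_recr /= IH addbA addbK.
Qed.

Section Sperner.
Variables (lab : nat -> nat -> nat -> bool * bool) (N : nat).

Let faceA a b c := door3 (lab a b c) (lab a b.+1 c) (lab a b.+1 c.+1) (+)
                   door3 (lab a b c) (lab a b c.+1) (lab a b.+1 c.+1).
Let faceB a b c := door3 (lab a b c) (lab a.+1 b c) (lab a.+1 b c.+1) (+)
                   door3 (lab a b c) (lab a b c.+1) (lab a.+1 b c.+1).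
Let faceC a b c := door3 (lab a b c) (lab a.+1 b c) (lab a.+1 b.+1 c) (+)
                   door3 (lab a b c) (lab a b.+1 c) (lab a.+1 b.+1 c).

(** Kuhn's tetrahedra are the monotone lattice paths between opposite corners of a cell; [p] and [q]
    are the inner vertices of the path. *)
Let tet a b c p q := uniq [:: lab a b c; lab p.1.1 p.1.2 p.2;
  lab q.1.1 q.1.2 q.2; lab a.+1 b.+1 c.+1].

(** A triangle inside the cell lies on two of its six tetrahedra and cancels; the twelve triangles
    on the surface remain. *)
Lemma kuhn_cell a b c :
  (tet a b c (a.+1, b, c) (a.+1, b.+1, c) (+)
   tet a b c (a.+1, b, c) (a.+1, b, c.+1)) (+)
  (tet a b c (a, b.+1, c) (a.+1, b.+1, c) (+)
   tet a b c (a, b.+1, c) (a, b.+1, c.+1)) (+)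
  (tet a b c (a, b, c.+1) (a.+1, b, c.+1) (+)
   tet a b c (a, b, c.+1) (a, b.+1, c.+1)) =
  (faceA a b c (+) faceA a.+1 b c) (+) (faceB a b c (+) faceB a b.+1 c) (+)
  (faceC a b c (+) faceC a b c.+1).
Proof.
rewrite /tet !door3_tetrahedron /faceA /faceB /faceC /= !addbE; btauto.
Qed.

Hypothesis lab_a0 : forall b c, b <= N -> c <= N -> (lab 0 b c).1.
Hypothesis lab_aN : forall b c, b <= N -> c <= N -> ~~ (lab N b c).1.
Hypothesis lab_b0 : forall a c, a <= N -> c <= N -> lab a 0 c != (false, true).
Hypothesis lab_bN : forall a c, a <= N -> c <= N -> lab a N c != (false, false).
Hypothesis lab_c0 : forall a b, a <= N -> b <= N -> lab a b 0 != (true, false).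
Hypothesis lab_cN : forall a b, a <= N -> b <= N -> lab a b N != (true, true).

Let door3_left (k l m : bool * bool) : k.1 -> l.1 -> m.1 -> door3 k l m = false.
Proof. by case: k l m => [[] []] [[] []] [[] []]. Qed.
Let door3_right (k l m : bool * bool) : ~~ k.1 -> ~~ l.1 -> ~~ m.1 ->
  door3 k l m = false.
Proof. by case: k l m => [[] []] [[] []] [[] []]. Qed.
Let door3_missing (x k l m : bool * bool) : x != (true, false) ->
  k != x -> l != x -> m != x -> door3 k l m = false.
Proof. by case: x k l m => [[] []] [[] []] [[] []] [[] []]. Qed.

(** Modulo 2 this counts the door edges on the boundary of the face. Only the side [a = N] has any:
    its labels are all left and run from left-bottom to left-top, so they change an odd number of
    times. *)
Lemma odd_door3_bottom :
  \big[addb/false]_(a < N) \big[addb/false]_(b < N) faceC a b 0.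
Proof.
pose edgeA a b := door2 (lab a b 0) (lab a b.+1 0).
pose edgeB a b := door2 (lab a b 0) (lab a.+1 b 0).
(* The diagonal belongs to both triangles of the square and cancels. *)
have cellE (a b : 'I_N) :
  faceC a b 0 = (edgeA a b (+) edgeA a.+1 b) (+) (edgeB a b (+) edgeB a b.+1).
  have [a1 b1] := (ltnW (ltn_ord a), ltnW (ltn_ord b)).
  rewrite /faceC !door3_triangle /edgeA /edgeB ?addbE; first by btauto.
    by rewrite !inE !negb_or !(eq_sym (true, false)) !lab_c0.
  by rewrite !inE !negb_or !(eq_sym (true, false)) !lab_c0.
under eq_bigr => a _ do
  (under eq_bigr => b _ do rewrite cellE; rewrite big_split /=).
rewrite big_split /= exchange_big /=.
under eq_bigr => b _ do rewrite (telescope_addb (fun a => edgeA a b)).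
rewrite [X in _ (+) X]big1 => [|a _]; last first.
  rewrite (telescope_addb (edgeB a)) /edgeB /door2.
  have a1 := ltnW (ltn_ord a).
  have := lab_b0 a1 (leq0n N); have := lab_b0 (ltn_ord a) (leq0n N).
  have := lab_bN a1 (leq0n N); have := lab_bN (ltn_ord a) (leq0n N).
  by do 4!case: (lab _ _ _) => [[] []].
rewrite addbF.
have edgeE (b : 'I_N) : edgeA 0 b (+) edgeA N b =
    (lab N b 0).2 (+) (lab N b.+1 0).2.
  have b1 := ltnW (ltn_ord b).
  rewrite /edgeA /door2 (negbTE (lab_aN b1 _)) //.
  rewrite (negbTE (lab_aN (ltn_ord b) _)) //.
  by rewrite lab_a0.
under eq_bigr => b _ do rewrite edgeE.
rewrite (telescope_addb (fun b => (lab N b 0).2)).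
have := lab_b0 (leqnn N) (leq0n N); have := lab_bN (leqnn N) (leq0n N).
have := lab_aN (leq0n N) (leq0n N); have := lab_aN (leqnn N) (leq0n N).
by do 2!case: (lab _ _ _) => [[] []].
Qed.

(** Summed over all cells, inner squares cancel. Every outer face except [c = 0] misses left-top,
    left-bottom or right-top, hence has no doors, while [c = 0] has an odd number. *)
Lemma sperner_tetrahedron : exists a b c p q,
  [/\ [/\ a < N, b < N & c < N],
      [/\ a <= p.1.1 <= a.+1, b <= p.1.2 <= b.+1, c <= p.2 <= c.+1 &
          p.1.1 + p.1.2 + p.2 = (a + b + c).+1],
      [/\ a <= q.1.1 <= a.+1, b <= q.1.2 <= b.+1, c <= q.2 <= c.+1 &
          q.1.1 + q.1.2 + q.2 = (a + b + c).+2]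
    & tet a b c p q].
Proof.
apply: contrapT => no_tet.
have {no_tet} noT (a b c : 'I_N) p q :
    [/\ a <= p.1.1 <= a.+1, b <= p.1.2 <= b.+1, c <= p.2 <= c.+1 &
          p.1.1 + p.1.2 + p.2 = (a + b + c).+1] ->
    [/\ a <= q.1.1 <= a.+1, b <= q.1.2 <= b.+1, c <= q.2 <= c.+1 &
          q.1.1 + q.1.2 + q.2 = (a + b + c).+2] -> tet a b c p q = false.
  move=> hp hq; apply/negP => t; apply: no_tet.
  by exists a, b, c, p, q; split=> //; rewrite !ltn_ord.
have cell0 (a b c : 'I_N) :
  (faceA a b c (+) faceA a.+1 b c) (+) (faceB a b c (+) faceB a b.+1 c) (+)
  (faceC a b c (+) faceC a b c.+1) = false.
  by rewrite -kuhn_cell !noT //= ?leqnn ?leqnSn; split=> //; lia.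
have : \big[addb/false]_(a < N) \big[addb/false]_(b < N)
  \big[addb/false]_(c < N)
  ((faceA a b c (+) faceA a.+1 b c) (+) (faceB a b c (+) faceB a b.+1 c) (+)
  (faceC a b c (+) faceC a b c.+1)) = false.
  by do 3!(rewrite big1 // => ? _).
under eq_bigr => a _ do (under eq_bigr => b _ do rewrite 2!big_split /=;
  rewrite 2!big_split /=).
rewrite 2!big_split /=.
rewrite exchange_big /= big1 => [|b _]; last first.
  rewrite exchange_big big1 // => c _ /=.
  have [b2 c2] := (ltn_ord b, ltn_ord c); have [b1 c1] := (ltnW b2, ltnW c2).
  rewrite (telescope_addb (fun a => faceA a b c)).
  have -> : faceA 0 b c = false by rewrite /faceA !door3_left ?lab_a0.
  by rewrite /faceA !door3_right ?lab_aN.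
rewrite addFb [X in X (+) _]big1 => [|a _]; last first.
  rewrite exchange_big big1 // => c _ /=.
  have [a2 c2] := (ltn_ord a, ltn_ord c); have [a1 c1] := (ltnW a2, ltnW c2).
  rewrite (telescope_addb (fun b => faceB a b c)).
  have -> : faceB a 0 c = false.
    by rewrite /faceB !(@door3_missing (false, true)) ?lab_b0.
  by rewrite /faceB !(@door3_missing (false, false)) ?lab_bN.
rewrite addFb.
under eq_bigr => a _ do under eq_bigr => b _ do
  rewrite (telescope_addb (faceC a b)).
have faceN (a b : 'I_N) : faceC a b N = false.
  have [a2 b2] := (ltn_ord a, ltn_ord b); have [a1 b1] := (ltnW a2, ltnW b2).
  by rewrite /faceC !(@door3_missing (true, true)) ?lab_cN.
under eq_bigr => a _ do under eq_bigr => b _ do rewrite faceN addbF.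
by rewrite odd_door3_bottom.
Qed.

End Sperner.

Lemma sperner_cube (lab : nat -> nat -> nat -> bool * bool) N :
  (forall b c, b <= N -> c <= N -> (lab 0 b c).1) ->
  (forall b c, b <= N -> c <= N -> ~~ (lab N b c).1) ->
  (forall a c, a <= N -> c <= N -> lab a 0 c != (false, true)) ->
  (forall a c, a <= N -> c <= N -> lab a N c != (false, false)) ->
  (forall a b, a <= N -> b <= N -> lab a b 0 != (true, false)) ->
  (forall a b, a <= N -> b <= N -> lab a b N != (true, true)) ->
  exists a b c (w : 'I_4 -> nat * nat * nat),
    [/\ a < N, b < N & c < N] /\
    [/\ forall k, [/\ a <= (w k).1.1 <= a.+1, b <= (w k).1.2 <= b.+1
                    & c <= (w k).2 <= c.+1],
        forall k, (w k).1.1 + (w k).1.2 + (w k).2 = a + b + c + k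
      & injective (fun k => lab (w k).1.1 (w k).1.2 (w k).2)].
Proof.
move=> a0 aN b0 bN c0 cN.
have [a [b [c [p [q [abcN hp hq tet]]]]]] :=
  sperner_tetrahedron a0 aN b0 bN c0 cN.
pose s := [:: (a, b, c); p; q; (a.+1, b.+1, c.+1)].
exists a, b, c, (fun k => nth p s k); split=> //; split.
- by case: hp hq => ? ? ? _ [? ? ? _] [[|[|[|[|//]]]] ?] /=; split=> //; lia.
- by case: hp hq => _ _ _ ? [_ _ _ ?] [[|[|[|[|//]]]] ?] /=; lia.
- pose x0 := lab p.1.1 p.1.2 p.2.
  have labE (k : 'I_4) : lab (nth p s k).1.1 (nth p s k).1.2 (nth p s k).2 =
      nth x0 [seq lab w.1.1 w.1.2 w.2 | w <- s] k by rewrite (nth_map p).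
  move=> k l; rewrite !labE => /eqP; rewrite nth_uniq ?size_map //.
  by move=> /eqP/val_inj.
Qed.

Local Open Scope classical_set_scope.
Local Open Scope ring_scope.

(** * The four quadrants cut out by two lines *)

Section Plane.
Variable R : realType.
Implicit Types (z d v : 'rV[R]_2) (A : set 'rV[R]_2) (p q : R * R * R).

(** Linear in [z] and zero at [d]: for [d != 0] its level sets are the lines of direction [d]. *)
Definition cross z d : R := z 0 0 * d 0 1 - z 0 1 * d 0 0.

Lemma eq_rV2 z z' : z 0 0 = z' 0 0 -> z 0 1 = z' 0 1 -> z = z'.
Proof.
move=> e0 e1; apply/rowP => j.
have [-> //|j0] := eqVneq j 0; rewrite (_ : j = 1) //.
by case: j j0 => [[|[|//]] ?] // _; exact/val_inj.
Qed.

Lemma rV2_eq0 d : (d == 0) = (d 0 0 ^+ 2 + d 0 1 ^+ 2 == 0).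
Proof.
rewrite paddr_eq0 ?sqr_ge0 // !sqrf_eq0.
apply/eqP/andP => [-> | [/eqP d0 /eqP d1]].
  by rewrite !mxE.
by apply: eq_rV2; rewrite mxE.
Qed.

Lemma cross_level_set d c : d != 0 ->
  exists p : 'rV[R]_2, forall z, cross z d = c -> line_through p d z.
Proof.
rewrite rV2_eq0 => d0.
(* [n] is orthogonal to [d] with [cross n d] equal to the squared length of [d], so the witness is
   the foot of the perpendicular from the origin. *)
pose n : 'rV[R]_2 := \row_j (if j == 0 then d 0 1 else - d 0 0).
exists ((c / (d 0 0 ^+ 2 + d 0 1 ^+ 2)) *: n) => z <-.
exists ((z 0 0 * d 0 0 + z 0 1 * d 0 1) / (d 0 0 ^+ 2 + d 0 1 ^+ 2)) => //.
by apply: eq_rV2; rewrite !mxE /cross /=; field.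
Qed.

Lemma crossD z z' d : cross (z + z') d = cross z d + cross z' d.
Proof. by rewrite /cross !mxE; ring. Qed.

Lemma crossZ t z d : cross (t *: z) d = t * cross z d.
Proof. by rewrite /cross !mxE; ring. Qed.

(** A quarter turn, so that [cross z (perp v)] is the scalar product of [z] and [v]. *)
Definition perp v : 'rV[R]_2 := \row_j (if j == 0 then - v 0 1 else v 0 0).

Lemma perp_comb_neq0 v (a b : R) : v != 0 -> (a != 0) || (b != 0) ->
  a *: perp v - b *: v != 0.
Proof.
rewrite !rV2_eq0 !mxE /= => v0 ab.
rewrite (_ : _ + _ = (a ^+ 2 + b ^+ 2) * (v 0 0 ^+ 2 + v 0 1 ^+ 2));
  last by ring.
by rewrite mulf_neq0 // paddr_eq0 ?sqr_ge0 // !sqrf_eq0 negb_and.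
Qed.

Definition sided (b : bool) (x : R) := 0 < (if b then x else - x).

Lemma convex_comb A z z' t :
  convex_set (A : set (convex_lmodType 'rV[R]_2)) -> A z -> A z' ->
  0 <= t <= 1 -> A (t *: z + (1 - t) *: z').
Proof.
move=> cA Az Az' /andP[t0 t1].
have := cA z z' (Itv01 t0 t1); rewrite !inE; exact.
Qed.

Lemma convex_sided A d c : convex_set (A : set (convex_lmodType 'rV[R]_2)) ->
  (forall z, A z -> cross z d <> c) ->
  exists b, forall z, A z -> sided b (cross z d - c).
Proof.
move=> cA Ac.
have [[z0 Az0]|A0] := pselect (A !=set0); last first.
  by exists true => z Az; case: A0; exists z.
wlog pos : d c Ac / c < cross z0 d => [hw|].
  have [lt_c|gt_c|eq_c] := ltgtP c (cross z0 d); [exact: hw| |by case: (Ac z0)].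
  have crossN z : cross z (- d) = - cross z d by rewrite /cross !mxE; ring.
  have [||b hb] := hw (- d) (- c); rewrite ?crossN ?ltrN2 //.
    by move=> z Az; rewrite crossN => /oppr_inj; apply: Ac.
  exists (~~ b) => z /hb; rewrite crossN /sided; case: b {hb} => /=; lra.
exists true => z Az; rewrite /sided subr_gt0 ltNge; apply/negP => zc.
have gap : 0 < cross z0 d - cross z d by lra.
(* The point of the segment at which the affine function takes the value [c]. *)
pose t := (c - cross z d) / (cross z0 d - cross z d).
apply: (Ac (t *: z0 + (1 - t) *: z)).
  apply: convex_comb => //.
  by rewrite /t divr_ge0 ?ler_pdivrMr //=; lra.
by rewrite crossD !crossZ /t; field; lra.
Qed.

(* Both affine functions are monotone in the parameter. If they increase (the
   other cases are alike), the right-bottom point comes after the left-top one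
   and also before it. *)
Lemma four_quadrants_no_line (f1 f2 g1 g2 : R) (s : bool * bool -> R) :
  ~ forall l, sided l.1 (f1 + s l * f2) /\ sided l.2 (g1 + s l * g2).
Proof.
move=> h.
have [] := (h (true, true), h (true, false)); rewrite /sided /=.
have [] := (h (false, true), h (false, false)); rewrite /sided /=.
set a := s _; set b := s _; set c := s _; set e := s _.
move=> -[f1a g1a] [f1b g1b] [f1c g1c] [f1e g1e].
have : 0 < (c - b) * f2 by lra.
have : 0 < (e - a) * f2 by lra.
have : 0 < (c - b) * g2 by lra.
have : 0 < (a - e) * g2 by lra.
nra.
Qed.

Section Cuts.
Variables (v : 'rV[R]_2) (M : R).

Definition cut1 p z : R := cross z v - M * p.1.1.

(* A rational parametrisation of the chords: as they run from [-1] to [1],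
   [p.1.2] moves the left end of the line from top to bottom and [p.2] the right
   end from bottom to top; at [+-1] that end leaves the box of size [M], emptying
   one of the quadrants there. *)
Definition cut2 p z : R :=
  (1 - p.1.2 * p.2) * cross z (perp v) - M * (p.2 - p.1.2) -
  (p.1.2 + p.2) * cut1 p z.

Definition quadrant p (l : bool * bool) : set 'rV[R]_2 :=
  [set z | sided l.1 (cut1 p z) /\ sided l.2 (cut2 p z)].

Definition cut_dir p : 'rV[R]_2 :=
  (1 - p.1.2 * p.2) *: perp v - (p.1.2 + p.2) *: v.

Lemma cut2E p z : cut2 p z =
  cross z (cut_dir p) - (M * (p.2 - p.1.2) - (p.1.2 + p.2) * (M * p.1.1)).
Proof. by rewrite /cut2 /cut1 /cut_dir /cross !mxE; ring. Qed.

(** If both coefficients vanished, [p.1.2 = - p.2] would give [- p.2 ^+ 2 = 1]. Where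
    [p.1.2 = p.2 = 1] or [-1], the two cuts are the same line. *)
Lemma cut_dir_neq0 p : v != 0 -> cut_dir p != 0.
Proof.
move=> v0; apply: perp_comb_neq0 => //; rewrite -negb_and.
apply/negP => /andP[/eqP a /eqP b].
have := sqr_ge0 p.2; nra.
Qed.

Lemma convex_quadrant p A : convex_set (A : set (convex_lmodType 'rV[R]_2)) ->
  (forall z, A z -> cut1 p z <> 0) -> (forall z, A z -> cut2 p z <> 0) ->
  exists l, A `<=` quadrant p l.
Proof.
move=> cA A1 A2.
have [z Az|b1 h1] := @convex_sided A v (M * p.1.1) cA.
  by move=> e; apply: (A1 z Az); rewrite /cut1 e subrr.
have [z Az|b2 h2] := @convex_sided A (cut_dir p)
    (M * (p.2 - p.1.2) - (p.1.2 + p.2) * (M * p.1.1)) cA.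
  by move=> e; apply: (A2 z Az); rewrite cut2E e subrr.
exists (b1, b2) => z Az; split => /=; first exact: h1.
by rewrite cut2E; exact: h2.
Qed.

(** Along a line both cuts are affine functions of the line's parameter. *)
Lemma quadrants_no_line p (L : set 'rV[R]_2) (C : bool * bool -> set 'rV[R]_2) :
  is_line L -> (forall l, C l `<=` quadrant p l) ->
  ~ forall l, L `&` C l !=set0.
Proof.
move=> [z [d [_ ->]]] CQ LC.
have /choice[s hs] l : exists s, C l (z + s *: d).
  by have [_ [[s _ <-] ?]] := LC l; exists s.
apply: (@four_quadrants_no_line (cut1 p z) (cross d v)
  (cut2 p z) (cross d (cut_dir p)) s) => l.
have [] := CQ _ _ (hs l); rewrite !cut2E /cut1 !crossD !crossZ => h1 h2.
by split; [move: h1|move: h2]; congr sided; ring.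
Qed.

(** * Stability of quadrants under small changes of the parameter *)

Lemma continuous_cross d : continuous (cross ^~ d).
Proof.
move=> z; have F := nbhs_filter z; apply: (@cvgB _ _ _ (nbhs z) F);
  apply: (@cvgM _ _ (nbhs z) F); (exact: cvg_cst || exact: coord_continuous).
Qed.

Lemma continuous_cuts :
  continuous (fun x : 'rV[R]_2 * (R * R * R) => cut1 x.2 x.1) /\
  continuous (fun x : 'rV[R]_2 * (R * R * R) => cut2 x.2 x.1).
Proof.
have c1 : continuous (fun x : 'rV[R]_2 * (R * R * R) => cut1 x.2 x.1).
  move=> x; rewrite /cut1; apply: cvgB.
    apply: (@continuous_comp _ _ _ fst (cross ^~ v)); first exact: cvg_fst.
    exact: continuous_cross.
  apply: cvgM; first exact: cvg_cst.
  apply: (@continuous_comp _ _ _ snd (fun p => p.1.1)); first exact: cvg_snd.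
  by apply: (@continuous_comp _ _ _ fst fst); exact: cvg_fst.
have cs : continuous (fun x : 'rV[R]_2 * (R * R * R) => x.2.1.2).
  move=> x.
  apply: (@continuous_comp _ _ _ snd (fun p => p.1.2)); first exact: cvg_snd.
  by apply: (@continuous_comp _ _ _ fst snd); [exact: cvg_fst|exact: cvg_snd].
have cu : continuous (fun x : 'rV[R]_2 * (R * R * R) => x.2.2).
  by move=> x; apply: (@continuous_comp _ _ _ snd snd); exact: cvg_snd.
split=> // x; rewrite /cut2; apply: cvgB; last first.
  by apply: cvgM; [apply: cvgD; [exact: cs|exact: cu]|exact: c1].
apply: cvgB; last first.
  by apply: cvgM; [exact: cvg_cst|apply: cvgB; [exact: cu|exact: cs]].
apply: cvgM.
  by apply: cvgB; [exact: cvg_cst|apply: cvgM; [exact: cs|exact: cu]].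
apply: (@continuous_comp _ _ _ fst (cross ^~ _)); first exact: cvg_fst.
exact: continuous_cross.
Qed.

Lemma near_sided b (T : topologicalType) (f : T -> R) x :
  {for x, continuous f} ->
  sided b (f x) -> \forall y \near x, sided b (f y).
Proof.
rewrite /sided => cf; case: b => fx; first exact: (cvgr_gt (f x) cf).
have : f x < 0 by rewrite -oppr_gt0.
move=> /(cvgr_lt (f x) cf); apply: filterS => y; by rewrite oppr_gt0.
Qed.

(** Tube lemma: the quadrant is an open condition on point and parameter jointly, and [A] is
    compact. *)
Lemma near_quadrant p l A : compact A -> A `<=` quadrant p l ->
  \forall q \near p, A `<=` quadrant q l.
Proof.
move=> /compact_near_coveringP cA Ap.
apply: (cA _ (nbhs p) (fun q z => quadrant q l z)) => z Az.
have [c1 c2] := continuous_cuts.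
have [s1 s2] := Ap z Az.
have h1 := @near_sided l.1 _ _ (z, p) (c1 _) s1.
have h2 := @near_sided l.2 _ _ (z, p) (c2 _) s2.
by apply: filterS2 h1 h2.
Qed.

Definition cube : set (R * R * R) := (`[-1, 1] `*` `[-1, 1]) `*` `[-1, 1].

Lemma compact_cube : compact cube.
Proof. by do 2?apply: compact_setX; exact: segment_compact. Qed.

(** A Lebesgue number for the cube. Holding for all small [e], it can be intersected over the four
    families. *)
Lemma lebesgue_quadrant (F : set (set 'rV[R]_2)) :
  (forall A, F A -> compact A) ->
  (forall p, exists A l, F A /\ A `<=` quadrant p l) ->
  \forall e \near 0^'+, forall p, cube p ->
    exists A l, F A /\ forall q, ball p e q -> A `<=` quadrant q l.
Proof.
move=> Fc FQ.
have /compact_near_coveringP cc := compact_cube.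
apply: (cc _ (0^'+) (fun e p => exists A l, F A /\
  forall q, ball p e q -> A `<=` quadrant q l)) => p _.
have [A [l [FA Ap]]] := FQ p.
have /nbhs_ballP[e /= e0 he] := near_quadrant (Fc _ FA) Ap.
exists (ball p (e / 2), [set x | x < e / 2]) => /=.
  split; first by apply: nbhsx_ballx; rewrite divr_gt0.
  by apply: nbhs_right_lt; rewrite divr_gt0.
move=> [q x] /= [pq xe]; exists A, l; split => // r qr; apply: he.
rewrite [e]splitr; apply: ball_triangle pq _.
by apply: le_ball qr; apply: ltW.
Qed.

End Cuts.
End Plane.

(** * Colorful families *)

Section Main.
Variable R : realType.
Implicit Types (z v : 'rV[R]_2) (A : set 'rV[R]_2) (p q : R * R * R).

Definition boxed v (M : R) : set 'rV[R]_2 :=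
  [set z | `|cross z v| <= M /\ `|cross z (perp v)| <= M].

(** On each face a cut has constant sign on part of the box. At [p.1.2 = -1], for example, [cut2] is
    [(1 + p.2) * (cross z (perp v) - M) + (1 - p.2) * cut1], which is not positive on the left. *)
Lemma quadrant_faces v M p l z : boxed v M z -> cube p -> quadrant v M p l z ->
  [/\ (p.1.1 = -1 -> l.1) /\ (p.1.1 = 1 -> ~~ l.1),
      (p.1.2 = -1 -> l != (false, true)) /\ (p.1.2 = 1 -> l != (false, false)) &
      (p.2 = -1 -> l != (true, false)) /\ (p.2 = 1 -> l != (true, true))].
Proof.
move=> [xM yM] [[_ /= s1] /= u1]; rewrite /quadrant /cut2 /=.
have f1E : cut1 v M p z = cross z v - M * p.1.1 by [].
move: xM yM s1 u1; rewrite !ler_norml !in_itv /=.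
move=> /andP[x1 x2] /andP[y1 y2] /andP[s1 s2] /andP[u1 u2] [h1 h2].
move: f1E h1 h2; set f1 := cut1 _ _ _ _ => f1E.
case: l => [[] []]; rewrite /sided /= => h1 h2.
all: split; split=> // e; exfalso; move: h2 h1;
  rewrite ?f1E e ?mulr1 ?mulrN1; try lra.
all: rewrite -?f1E => h2 h1; nra.
Qed.

Lemma near_boxed v (F : set (set 'rV[R]_2)) : finite_set F ->
  (forall A, F A -> compact A) ->
  \forall M \near +oo, forall A, F A -> A `<=` boxed v M.
Proof.
move=> /finite_fsetP[D FD] Fc; rewrite FD in Fc *.
apply: (@filter_bigI _ _ D (fun A M => A `<=` boxed v M)) => A AD.
have near1 d : \forall M \near +oo, forall z, A z -> `|cross z d| <= M.
  have /compact_bounded : compact ((fun z => cross z d) @` A).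
    apply: continuous_compact; last exact: Fc.
    by apply: continuous_subspaceT; exact: continuous_cross.
  move=> [M0 [M0r h]]; exists M0; split=> //.
  by move=> M /h hM z Az; apply: hM; exists z.
by apply: filterS2 (near1 v) (near1 (perp v)) => M h1 h2 z Az;
  split; [exact: h1|exact: h2].
Qed.

Definition grid_pt N (w : nat * nat * nat) : R * R * R :=
  (2 * w.1.1%:R / N%:R - 1, 2 * w.1.2%:R / N%:R - 1, 2 * w.2%:R / N%:R - 1).

Lemma grid_pt_ball N (w w' : nat * nat * nat) (e : R) :
  (0 < N)%N -> 2 < e * N%:R ->
  [/\ w.1.1 <= w'.1.1 <= w.1.1.+1, w.1.2 <= w'.1.2 <= w.1.2.+1
    & w.2 <= w'.2 <= w.2.+1]%N ->
  ball (grid_pt N w') e (grid_pt N w).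
Proof.
move=> N0 eN [h1 h2 h3].
have coord (m n : nat) : (m <= n <= m.+1)%N ->
    ball (2 * n%:R / N%:R - 1 : R) e (2 * m%:R / N%:R - 1).
  move=> /andP[mn nm]; rewrite -ball_normE /= opprB addrA subrK -mulrBl -mulrBr.
  have N0' : 0 < N%:R :> R by rewrite ltr0n.
  rewrite ger0_norm; last by rewrite divr_ge0 ?mulr_ge0 ?subr_ge0 ?ler_nat.
  rewrite ltr_pdivrMr // (le_lt_trans _ eN) //.
  rewrite -[leRHS]mulr1 ler_pM2l // lerBlDr.
  by rewrite nat1r ler_nat.
by split; [split|]; exact: coord.
Qed.

Lemma grid_pt_cube N (w : nat * nat * nat) : (0 < N)%N ->
  [/\ w.1.1 <= N, w.1.2 <= N & w.2 <= N]%N -> cube (grid_pt N w).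
Proof.
move=> N0 [h1 h2 h3].
have coord (n : nat) : (n <= N)%N -> `[-1, 1]%classic (2 * n%:R / N%:R - 1 : R).
  move=> nN; have N0' : 0 < N%:R :> R by rewrite ltr0n.
  rewrite /= in_itv /= lerBDr addrC subrr divr_ge0 ?mulr_ge0 //= lerBlDr.
  by rewrite ler_pdivrMr // -[1 + 1]/2%:R ler_pM2l // ler_nat.
by split; [split|]; exact: coord.
Qed.

Lemma grid_pt0 N : 2 * 0%:R / N%:R - 1 = -1 :> R.
Proof. by rewrite mulr0 mul0r sub0r. Qed.

Lemma grid_ptN N : (0 < N)%N -> 2 * N%:R / N%:R - 1 = 1 :> R.
Proof. by move=> N0; rewrite mulfK ?pnatr_eq0 -?lt0n //; lra. Qed.

Lemma colorful_quadrants v M (F : 'I_4 -> set (set 'rV[R]_2)) :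
  (forall i A, F i A -> compact A) -> (forall i A, F i A -> A !=set0) ->
  (forall i A, F i A -> A `<=` boxed v M) ->
  (forall i p, exists A l, F i A /\ A `<=` quadrant v M p l) ->
  exists p (C : 'I_4 -> set 'rV[R]_2) (c : bool * bool -> 'I_4),
    colorful F C /\ forall l, C (c l) `<=` quadrant v M p l.
Proof.
move=> Fc F0 FM FQ.
have : \forall e \near 0^'+, forall i p, cube p ->
    exists A l, F i A /\ forall q, ball p e q -> A `<=` quadrant v M q l.
  by apply: filter_forall => i; apply: lebesgue_quadrant; [exact: Fc|exact: FQ].
move=> /(filterI (nbhs_right_gt 0))/filter_ex[e [/= e0 he]].
(* Grid neighbours differ by at most [2 / N] in each coordinate, so a cell fits in the [e]-ball of
   any of its vertices. *)
have [N N0 eN] : exists2 N, (0 < N)%N & 2 < e * N%:R.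
  have [N _ hN] := nbhs_infty_gtr (2 / e).
  exists N.+1 => //; rewrite mulrC -ltr_pdivrMr //.
  by apply: hN => /=; exact: leqnSn.
pose owner (w : nat * nat * nat) : 'I_4 := inord ((w.1.1 + w.1.2 + w.2) %% 4).
(* [g w] is a member of the owner's family with a label valid on the whole ball around [w]; off the
   grid its value is arbitrary. *)
have /choice[g hg] (w : nat * nat * nat) :
    exists Al : set 'rV[R]_2 * (bool * bool),
    [/\ w.1.1 <= N, w.1.2 <= N & w.2 <= N]%N -> F (owner w) Al.1 /\
    forall q, ball (grid_pt N w) e q -> Al.1 `<=` quadrant v M q Al.2.
  have [wN|wN] := pselect [/\ w.1.1 <= N, w.1.2 <= N & w.2 <= N]%N; last first.
    by exists (set0, (true, true)).
  have [A [l Al]] := he (owner w) _ (grid_pt_cube N0 wN).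
  by exists (A, l).
have faces (w : nat * nat * nat) : [/\ w.1.1 <= N, w.1.2 <= N & w.2 <= N]%N ->
  let p := grid_pt N w in let l := (g w).2 in
  [/\ (p.1.1 = -1 -> l.1) /\ (p.1.1 = 1 -> ~~ l.1),
      (p.1.2 = -1 -> l != (false, true)) /\ (p.1.2 = 1 -> l != (false, false)) &
      (p.2 = -1 -> l != (true, false)) /\ (p.2 = 1 -> l != (true, true))].
  move=> wN; have [Fw Qw] := hg _ wN.
  have [z Az] := F0 _ _ Fw.
  apply: (@quadrant_faces v M _ _ z); first exact: FM Fw _ Az.
    exact: grid_pt_cube.
  by apply: Qw Az; exact: ballxx.
have [||||||a [b [c [w [[aN bN cN] [near_w sum_w inj_w]]]]]] :=
    @sperner_cube (fun a b c => (g (a, b, c)).2) N.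
- move=> b c bN cN; have [//|[h _] _ _] := faces (0, b, c)%N.
  by apply: h; exact: grid_pt0.
- move=> b c bN cN; have [//|[_ h] _ _] := faces (N, b, c).
  by apply: h; exact: grid_ptN.
- move=> a c aN cN; have [//|_ [h _] _] := faces (a, 0, c)%N.
  by apply: h; exact: grid_pt0.
- move=> a c aN cN; have [//|_ [_ h] _] := faces (a, N, c).
  by apply: h; exact: grid_ptN.
- move=> a b aN bN; have [//|_ _ [h _]] := faces (a, b, 0)%N.
  by apply: h; exact: grid_pt0.
- move=> a b aN bN; have [//|_ _ [_ h]] := faces (a, b, N).
  by apply: h; exact: grid_ptN.
have wN k : [/\ (w k).1.1 <= N, (w k).1.2 <= N & (w k).2 <= N]%N.
  by have [] := near_w k; split; lia.
have inj_owner : injective (owner \o w).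
  move=> k l /(congr1 val); rewrite /= /owner !sum_w !inordK ?ltn_mod // => kl.
  by apply: val_inj; move: kl (ltn_ord k) (ltn_ord l) => /=; lia.
have [color colorK ownerK] := injF_bij inj_owner.
have inj_lab : injective (fun k => (g (w k)).2).
  by move=> k l; have := inj_w k l; case: (w k) (w l) => [[? ?] ?] [[? ?] ?].
have [|vertex vertexK labK] := inj_card_bij inj_lab.
  by rewrite card_prod card_bool card_ord.
(* The base vertex lies in the balls of all four vertices, so its pair of lines serves the four
   chosen sets at once. *)
exists (grid_pt N (a, b, c)), (fun i => (g (w (color i))).1),
  (fun l => owner (w (vertex l))).
split=> [i|l].
  by have := (hg _ (wN (color i))).1; rewrite (ownerK i : owner _ = i).
rewrite (colorK _ : color (owner (w _)) = _) -{2}(labK l).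
by apply: (hg _ (wN _)).2; apply: grid_pt_ball.
Qed.

End Main.

Theorem theorem3p10 (R : realType) (F : 'I_4 -> set (set 'rV[R]_2))
  (v : 'rV[R]_2)
  (F_finite : forall i, finite_set (F i))
  (F_compact : forall i A, F i A -> compact A)
  (F_convex : forall i (A : set 'rV[R]_2), F i A ->
    convex_set (A : set (convex_lmodType 'rV[R]_2)))
  (F_colorful : forall C : 'I_4 -> set 'rV[R]_2,
    colorful F C -> pierced_by_a_line (range C))
  (v_neq0 : v != 0) :
  exists i : 'I_4, exists L : 'I_2 -> set 'rV[R]_2,
    pierced_by_lines (F i) L /\ exists j : 'I_2, parallel_to (L j) v.
Proof.
apply: contrapT => not_pierced.
have F_neq0 i : exists A, F i A.
  (* An empty family is pierced vacuously, here by the same line twice. *)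
  apply: contrapT => F0; apply: not_pierced; exists i, (fun=> line_through 0 v).
  split; last by exists 0, 0.
  by split=> [_|A FA]; [exists 0, v | case: F0; exists A].
have [C0 C0F] := choice F_neq0.
have set_neq0 i A : F i A -> A !=set0.
  (* Put [A] into a colorful collection: the piercing line meets it. *)
  move=> FA; pose C j := if j == i then A else C0 j.
  have [j|L [_ LC]] := F_colorful C; first by rewrite /C; case: eqP => [->|].
  have [|z [_]] := LC A; last by exists z.
  by exists i => //; rewrite /C eqxx.
have [M FM] : exists M, forall i A, F i A -> A `<=` boxed v M.
  have : \forall M \near +oo, forall i A, F i A -> A `<=` boxed v M.
    by apply: filter_forall => i; apply: near_boxed;
      [exact: F_finite|exact: F_compact].
  by move=> /filter_ex.
have [|p [C [c [CF CQ]]]] := colorful_quadrants F_compact set_neq0 FM.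
  (* A convex set missing both cut lines lies in a quadrant; if no member of [F i] does, these two
     lines pierce [F i], and line [0] is parallel to [v]. *)
  move=> i p; apply: contrapT => noQ; apply: not_pierced.
  have [q1 line1] := cross_level_set (M * p.1.1) v_neq0.
  have [q2 line2] := cross_level_set
    (M * (p.2 - p.1.2) - (p.1.2 + p.2) * (M * p.1.1))
    (cut_dir_neq0 p v_neq0).
  pose L (j : 'I_2) :=
    if j == 0 then line_through q1 v else line_through q2 (cut_dir v p).
  exists i, L; split; last by exists 0, q1.
  split=> [j|A FA].
    rewrite /L; case: eqP => _; [exists q1, v => //|exists q2, (cut_dir v p)].
    by split=> //; exact: cut_dir_neq0.
  apply: contrapT => missed; apply: noQ.
  suff [l Al] : exists l, A `<=` quadrant v M p l by exists A, l.
  apply: convex_quadrant; first exact: F_convex FA.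
    move=> z Az /eqP; rewrite subr_eq0 => /eqP/line1 zL.
    by apply: missed; exists z; split=> //; exists 0.
  move=> z Az /eqP; rewrite cut2E subr_eq0 => /eqP/line2 zL.
  by apply: missed; exists z; split=> //; exists 1.
have [L [lineL LC]] := F_colorful C CF.
apply: (quadrants_no_line lineL CQ) => l.
by apply: LC; exists (c l).
Qed.
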